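(* Let $M\subset\mathbb{R}^n$ be closed and let $K\colon\mathbb{R}^n\rightrightarrows\mathbb{R}^m$ be a set-valued mapping with closed graph. Let $\bar z\in M\cap\operatorname{dom}K$ be a point at which $K$ is inner semicompact w.r.t. $\operatorname{dom}K$. Define $$\Upsilon_{\mathrm{imp}}(z):=(z,z)-M\times\operatorname{dom}K\ \ (z\in\mathbb{R}^n),\qquad \Upsilon_{\mathrm{exp}}(z,\lambda):=(z,z,\lambda)-M\times\operatorname{gph}K\ \ ((z,\lambda)\in\mathbb{R}^n\times\mathbb{R}^m).$$ Assume that, for each $\bar\lambda\in K(\bar z)$, $\Upsilon_{\mathrm{exp}}$ is metrically subregular at $((\bar z,\bar\lambda),(0,0,0))$. Then $\Upsilon_{\mathrm{imp}}$ is metrically subregular at $(\bar z,(0,0))$.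
   Context: $\operatorname{gph}K:=\{(z,\lambda)\mid\lambda\in K(z)\}$, $\operatorname{dom}K:=\{z\mid K(z)\neq\emptyset\}$. $K$ is inner semicompact w.r.t. $\operatorname{dom}K$ at $\bar z\in\operatorname{dom}K$ if for each sequence $\{z_k\}\subset\operatorname{dom}K$ with $z_k\to\bar z$ there is a sequence $\{\lambda_k\}\subset\mathbb{R}^m$ possessing a bounded subsequence such that $\lambda_k\in K(z_k)$ for all $k$. A set-valued mapping $\Upsilon$ is metrically subregular at $(\bar x,\bar y)\in\operatorname{gph}\Upsilon$ if there are $\kappa>0$ and a neighborhood $U$ of $\bar x$ such that $\operatorname{dist}(x,\Upsilon^{-1}(\bar y))\le\kappa\operatorname{dist}(\bar y,\Upsilon(x))$ for all $x\in U$, where $\Upsilon^{-1}(\bar y)=\{x\mid\bar y\in\Upsilon(x)\}$. *)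

(* Defs.v *)
From mathcomp Require Import all_boot all_order all_algebra.
From mathcomp Require Import all_classical all_reals all_analysis.

Set Implicit Arguments.
Unset Strict Implicit.
Unset Printing Implicit Defensive.

Import Order.TTheory GRing.Theory Num.Theory.
Import numFieldNormedType.Exports.

Local Open Scope classical_set_scope.
Local Open Scope ring_scope.

(* R^n is 'rV[R]_n and R^n x R^m is 'rV[R]_(n + m), the pair (x, y) being
   row_mx x y, so that Euclidean norms of pairs need no separate definition.
   The topology on 'rV[R]_n is the library's, i.e. the usual one; distances are
   Euclidean, whereas the library norm on 'rV[R]_n is the maximum norm. *)

Definition eucl_norm (R : realType) (n : nat) (x : 'rV[R]_n) : R :=
  Num.sqrt (\sum_(i < n) x ord0 i ^+ 2).

(* Extended real-valued, so that the distance to the empty set is +oo. *)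
Definition eucl_dist (R : realType) (n : nat) (x : 'rV[R]_n)
    (A : set 'rV[R]_n) : \bar R :=
  ereal_inf [set (eucl_norm (x - a))%:E | a in A].

Definition row_setX (R : realType) (n m : nat)
    (A : set 'rV[R]_n) (B : set 'rV[R]_m) : set 'rV[R]_(n + m) :=
  [set v | A (lsubmx v) /\ B (rsubmx v)].

(* The Minkowski difference x - A of a point and a set. *)
Definition point_sub_set (R : realType) (n : nat) (x : 'rV[R]_n)
    (A : set 'rV[R]_n) : set 'rV[R]_n :=
  [set x - a | a in A].

Section SetValued.
Variables (R : realType) (n m : nat) (F : 'rV[R]_n -> set 'rV[R]_m).

Definition gph : set 'rV[R]_(n + m) := [set v | F (lsubmx v) (rsubmx v)].

Definition dom : set 'rV[R]_n := [set z | F z !=set0].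

Definition setval_inv (y : 'rV[R]_m) : set 'rV[R]_n := [set x | F x y].

Definition inner_semicompact_dom (zbar : 'rV[R]_n) : Prop :=
  forall z : nat -> 'rV[R]_n,
    (forall k, dom (z k)) -> z @ \oo --> zbar ->
    exists lam : nat -> 'rV[R]_m,
      (forall k, F (z k) (lam k)) /\
      exists phi : nat -> nat,
        {homo phi : i j / (i < j)%N} /\
        exists C : R, forall k, eucl_norm (lam (phi k)) <= C.

Definition metrically_subregular (xbar : 'rV[R]_n) (ybar : 'rV[R]_m) : Prop :=
  gph (row_mx xbar ybar) /\
  exists kappa : R, 0 < kappa /\
  exists U : set 'rV[R]_n, nbhs xbar U /\
    forall x, U x ->
      (eucl_dist x (setval_inv ybar) <= kappa%:E * eucl_dist ybar (F x))%E.

End SetValued.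

Definition Upsilon_imp (R : realType) (n m : nat) (M : set 'rV[R]_n)
    (K : 'rV[R]_n -> set 'rV[R]_m) (z : 'rV[R]_n) : set 'rV[R]_(n + n) :=
  point_sub_set (row_mx z z) (row_setX M (dom K)).

(* The argument v encodes the pair (z, lambda). *)
Definition Upsilon_exp (R : realType) (n m : nat) (M : set 'rV[R]_n)
    (K : 'rV[R]_n -> set 'rV[R]_m) (v : 'rV[R]_(n + m)) :
    set 'rV[R]_(n + (n + m)) :=
  let z := lsubmx v in let lambda := rsubmx v in
  point_sub_set (row_mx z (row_mx z lambda)) (row_setX M (gph K)).

(* Main.v *)
Require Import Defs.
From mathcomp Require Import all_boot all_order all_algebra.
From mathcomp Require Import all_classical all_reals all_analysis.
Import Order.TTheory GRing.Theory Num.Theory.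
Import numFieldNormedType.Exports.
Local Open Scope classical_set_scope.
Local Open Scope ring_scope.
Set Implicit Arguments.
Unset Strict Implicit.
Unset Printing Implicit Defensive.

(** Subregularity of [z |-> g z - A] at a zero is a local error bound: near the
    reference point, [dist (x, g^-1 A) <= kappa * dist (g x, A)]
    ([metrically_subregular0P]).  Both hypotheses and conclusion are of this
    form, with [g^-1 A] equal to [S := M `&` dom K] for [Upsilon_imp] and to
    the part of [gph K] above [M] for [Upsilon_exp].

    The theorem goes by contradiction.  If the error bound for [Upsilon_imp]
    fails near [zbar], there are [z_k --> zbar] and points [a_k] of [M], [b_k]
    of [dom K] with
      [(k + 1) * |(z_k - a_k, z_k - b_k)| < dist (z_k, S)]
    ([not_subregular0_seq]); since [zbar] is in [S], this forces
    [b_k --> zbar].  Inner semicompactness yields multipliers [lam_k] in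
    [K b_k], bounded along a subsequence, hence with a cluster point [l]
    ([bounded_seq_cluster]), and [l] is in [K zbar] because the graph of [K] is
    closed.  So [Upsilon_exp] has an error bound near [(zbar, l)], with some
    constant [kappa].  The decisive choice is to use it at [(z_k, lam_k)], the
    multiplier of the nearby point [b_k]: the point
    [(a_k, (b_k, lam_k))] of [M * gph K] has then no error in its last
    component, whence
      [dist (z_k, S) <= dist ((z_k, lam_k), gph K above M)
                     <= kappa * |(z_k - a_k, z_k - b_k, 0)|],
    a contradiction as soon as [kappa <= k + 1].  Only one such index [k] is
    needed, so a cluster point does the work of a convergent subsequence. *)

(** * Euclidean norm and distance on row vectors *)

Lemma eucl_norm_ge0 (R : realType) n (x : 'rV[R]_n) : 0 <= eucl_norm x.
Proof. exact: sqrtr_ge0. Qed.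

Lemma sqr_eucl_norm (R : realType) n (x : 'rV[R]_n) :
  eucl_norm x ^+ 2 = \sum_(i < n) x ord0 i ^+ 2.
Proof. by rewrite sqr_sqrtr// sumr_ge0// => i _; rewrite sqr_ge0. Qed.

Lemma eucl_norm0 (R : realType) n : eucl_norm (0 : 'rV[R]_n) = 0.
Proof. by rewrite /eucl_norm big1 ?sqrtr0// => i _; rewrite mxE expr0n. Qed.

Lemma eucl_normN (R : realType) n (x : 'rV[R]_n) :
  eucl_norm (- x) = eucl_norm x.
Proof. by congr Num.sqrt; apply: eq_bigr => i _; rewrite mxE sqrrN. Qed.

Lemma eucl_norm_row_mx (R : realType) n m (x : 'rV[R]_n) (y : 'rV[R]_m) :
  eucl_norm (row_mx x y) = Num.sqrt (eucl_norm x ^+ 2 + eucl_norm y ^+ 2).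
Proof.
rewrite !sqr_eucl_norm /eucl_norm big_split_ord /=; congr Num.sqrt.
by congr (_ + _); apply: eq_bigr => i _; rewrite (row_mxEl, row_mxEr).
Qed.

Lemma le_eucl_norm_row_mxl (R : realType) n m (x : 'rV[R]_n) (y : 'rV[R]_m) :
  eucl_norm x <= eucl_norm (row_mx x y).
Proof.
rewrite eucl_norm_row_mx -{1}(ger0_norm (eucl_norm_ge0 _)) -sqrtr_sqr.
by rewrite ler_wsqrtr// lerDl sqr_ge0.
Qed.

Lemma le_eucl_norm_row_mxr (R : realType) n m (x : 'rV[R]_n) (y : 'rV[R]_m) :
  eucl_norm y <= eucl_norm (row_mx x y).
Proof.
rewrite eucl_norm_row_mx -{1}(ger0_norm (eucl_norm_ge0 _)) -sqrtr_sqr.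
by rewrite ler_wsqrtr// lerDr sqr_ge0.
Qed.

Lemma eucl_norm_row_mx0 (R : realType) n m (x : 'rV[R]_n) :
  eucl_norm (row_mx x (0 : 'rV[R]_m)) = eucl_norm x.
Proof.
by rewrite eucl_norm_row_mx eucl_norm0 expr0n addr0 sqrtr_sqr ger0_norm// eucl_norm_ge0.
Qed.

Lemma entry_le_eucl_norm (R : realType) n (x : 'rV[R]_n) i :
  `|x ord0 i| <= eucl_norm x.
Proof.
rewrite -sqrtr_sqr ler_wsqrtr// (bigD1 i)//= lerDl.
by rewrite sumr_ge0// => j _; rewrite sqr_ge0.
Qed.

(** With [eucl_norm_le_mx_norm], the link between Euclidean estimates and the
    topology, which is that of the maximum norm. *)
Lemma mx_norm_le_eucl_norm (R : realType) n (x : 'rV[R]_n) : `|x| <= eucl_norm x.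
Proof.
rewrite /Num.norm/= mx_normrE; apply: bigmax_le => [|[i j] _].
  exact: eucl_norm_ge0.
by rewrite ord1 entry_le_eucl_norm.
Qed.

Lemma eucl_norm_le_mx_norm (R : realType) n (x : 'rV[R]_n) :
  eucl_norm x <= Num.sqrt n%:R * `|x|.
Proof.
have -> : `|x| = Num.sqrt (`|x| ^+ 2) by rewrite sqrtr_sqr normr_id.
rewrite -sqrtrM// ler_wsqrtr//.
rewrite -[X in X%:R * _](card_ord n) mulr_natl -sumr_const ler_sum// => i _.
rewrite -[x ord0 i ^+ 2]real_normK ?num_real// ler_pXn2r ?nnegrE//.
rewrite [leRHS]/Num.norm/= mx_normrE.
exact: (le_bigmax _ (fun ij : 'I_1 * 'I_n => `|x ij.1 ij.2|) (ord0, i)).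
Qed.

Lemma eucl_dist_le (R : realType) n (x a : 'rV[R]_n) (A : set 'rV[R]_n) :
  A a -> (eucl_dist x A <= (eucl_norm (x - a))%:E)%E.
Proof. by move=> Aa; apply: ereal_inf_lbound; exists a. Qed.

(** The infimum need not be attained, but a strict bound on it passes to some
    point of the set; for [A] empty the left-hand side is [+oo]. *)
Lemma eucl_dist_scale_lt (R : realType) n (x : 'rV[R]_n) (A : set 'rV[R]_n)
    (k : R) (D : \bar R) :
  0 < k -> (k%:E * eucl_dist x A < D)%E ->
  exists2 a, A a & ((k * eucl_norm (x - a))%:E < D)%E.
Proof.
move=> k0 ltD; apply: contrapT => nex; move: ltD; apply/negP; rewrite -leNgt.
rewrite -lee_pdivrMl//; apply: le_ereal_inf_tmp => _ [a Aa <-].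
rewrite lee_pdivrMl// -EFinM leNgt; apply/negP => lta.
by apply: nex; exists a.
Qed.

(** Projecting onto the first block does not increase distances: this is how an
    error bound in the variables [(z, lambda)] gives one in [z] alone. *)
Lemma eucl_dist_lsubmx (R : realType) n m (v : 'rV[R]_(n + m))
    (A : set 'rV[R]_n) (B : set 'rV[R]_(n + m)) :
  (forall w, B w -> A (lsubmx w)) ->
  (eucl_dist (lsubmx v) A <= eucl_dist v B)%E.
Proof.
move=> BA; apply: le_ereal_inf_tmp => _ [w Bw <-].
apply: (le_trans (eucl_dist_le _ (BA _ Bw))); rewrite lee_fin.
rewrite -linearB/= -[in leRHS](hsubmxK (v - w)).
exact: le_eucl_norm_row_mxl.
Qed.

(** * Subregularity as a local error bound *)

Lemma row_setX_row_mx (R : realType) n m (A : set 'rV[R]_n) (B : set 'rV[R]_m)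
    (x : 'rV[R]_n) (y : 'rV[R]_m) :
  row_setX A B (row_mx x y) = (A x /\ B y).
Proof. by rewrite /row_setX /= row_mxKl row_mxKr. Qed.

Lemma gph_row_mx (R : realType) n m (F : 'rV[R]_n -> set 'rV[R]_m)
    (x : 'rV[R]_n) (y : 'rV[R]_m) :
  gph F (row_mx x y) = F x y.
Proof. by rewrite /gph /= row_mxKl row_mxKr. Qed.

Lemma point_sub_set0 (R : realType) n (x : 'rV[R]_n) (A : set 'rV[R]_n) :
  point_sub_set x A 0 = A x.
Proof.
apply/propext; split => [[a Aa /eqP]|Ax]; last by exists x; rewrite ?subrr.
by rewrite subr_eq0 => /eqP ->.
Qed.

Lemma eucl_dist_point_sub_set (R : realType) n (x : 'rV[R]_n)
    (A : set 'rV[R]_n) : eucl_dist 0 (point_sub_set x A) = eucl_dist x A.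
Proof.
congr ereal_inf; apply/seteqP; split => [_ [_ [a Aa <-] <-]|_ [a Aa <-]].
  by exists a => //; rewrite sub0r eucl_normN.
by exists (x - a); [exists a|rewrite sub0r eucl_normN].
Qed.

(** The mapping contains [0] at [x] exactly when [g x] is in [A], and reflecting
    and translating [A] does not change distances. *)
Lemma metrically_subregular0P (R : realType) p q (g : 'rV[R]_p -> 'rV[R]_q)
    (A : set 'rV[R]_q) (x0 : 'rV[R]_p) :
  metrically_subregular (fun x => point_sub_set (g x) A) x0 0 <->
  A (g x0) /\ exists kappa : R, 0 < kappa /\ \forall x \near x0,
    (eucl_dist x (g @^-1` A) <= kappa%:E * eucl_dist (g x) A)%E.
Proof.
rewrite /metrically_subregular gph_row_mx point_sub_set0.
have -> : setval_inv (fun x => point_sub_set (g x) A) 0 = g @^-1` A.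
  by apply/seteqP; split => x; rewrite /setval_inv/= point_sub_set0.
split=> -[Ax0 [kappa [kappa0 H]]]; split=> //; exists kappa; split=> //.
  case: H => U [nU HU]; apply: filterS nU => x /HU.
  by rewrite eucl_dist_point_sub_set.
by eexists; split; [exact: H|] => x; rewrite eucl_dist_point_sub_set.
Qed.

(** Testing the error bound with the constant [k + 1] on the ball of radius
    [1 / (k + 1)] gives a violating [x k], and the strictness of the violation
    lets the distance to [A] be replaced by the norm at one point [w k] of [A].
    The residual tends to [0] since [dist (x k, g^-1 A) <= |x k - x0|]. *)
Lemma not_subregular0_seq (R : realType) p q (g : 'rV[R]_p -> 'rV[R]_q)
    (A : set 'rV[R]_q) (x0 : 'rV[R]_p) :
  A (g x0) -> ~ metrically_subregular (fun x => point_sub_set (g x) A) x0 0 ->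
  exists (x : nat -> 'rV[R]_p) (w : nat -> 'rV[R]_q),
    [/\ x @ \oo --> x0,
      (fun k => eucl_norm (g (x k) - w k)) @ \oo --> (0 : R),
      forall k, A (w k) &
      forall k, ((k.+1%:R * eucl_norm (g (x k) - w k))%:E <
        eucl_dist (x k) (g @^-1` A))%E].
Proof.
move=> Ax0 nsub.
have bad k : exists xw : 'rV[R]_p * 'rV[R]_q,
    [/\ ball x0 k.+1%:R^-1 xw.1, A xw.2 &
      ((k.+1%:R * eucl_norm (g xw.1 - xw.2))%:E <
        eucl_dist xw.1 (g @^-1` A))%E].
  apply: contrapT => nbad; apply/nsub/metrically_subregular0P; split=> //.
  exists k.+1%:R; split=> //.
  have k0 : 0 < (k.+1%:R : R)^-1 by rewrite invr_gt0.
  apply: filterS (nbhsx_ballx x0 _ k0) => x xk; rewrite leNgt; apply/negP.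
  by move=> /eucl_dist_scale_lt[//|w Aw ltw]; apply: nbad; exists (x, w).
have [xw xwP] := choice bad.
have xcvg : (fun k => (xw k).1) @ \oo --> x0.
  apply/cvg_ballP => e e0.
  near=> k; have [xk _ _] := xwP k; apply: le_ball xk.
  by apply: ltW; near: k; exact: near_infty_natSinv_lt (PosNum e0).
exists (fun k => (xw k).1), (fun k => (xw k).2); split=> [//||k|k]; first last.
- by have [] := xwP k.
- by have [] := xwP k.
(* As [x0] is itself feasible, the residual is at most [|x k - x0|]. *)
apply: (@squeeze_cvgr _ _ _ _ (cst 0)
    (fun k => Num.sqrt p%:R * `|(xw k).1 - x0|)).
- near=> k; rewrite /= eucl_norm_ge0 /=; have [_ _ ltk] := xwP k.
  have {ltk} := lt_le_trans ltk (eucl_dist_le (A := g @^-1` A) (xw k).1 Ax0).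
  rewrite lte_fin => /ltW lek.
  apply: le_trans (eucl_norm_le_mx_norm _); apply: le_trans lek.
  by rewrite ler_peMl ?eucl_norm_ge0// ler1n.
- exact: cvg_cst.
- rewrite -[X in _ --> X](mulr0 (Num.sqrt p%:R)); apply: cvgMl_tmp.
  rewrite -[X in _ --> X](@normr0 _ 'rV[R]_p); apply: cvg_norm.
  by rewrite -[X in _ --> X](subrr x0); apply: cvgB => //; exact: cvg_cst.
Unshelve. all: by end_near. Qed.

(** * Sequences and neighbourhoods *)

Lemma nbhs_row_mx (R : realType) n m (x : 'rV[R]_n) (y : 'rV[R]_m)
    (U : set 'rV[R]_(n + m)) :
  nbhs (row_mx x y) U ->
  exists2 e : R, 0 < e &
    forall x' y', ball x e x' -> ball y e y' -> U (row_mx x' y').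
Proof.
move=> /nbhs_ballP[e e0 eU]; exists e => // x' y' [_ xx'] [_ yy'].
apply: eU; split=> // i j; case: (split_ordP j) => k ->.
  by rewrite !row_mxEl.
by rewrite !row_mxEr.
Qed.

(** Bolzano-Weierstrass, in the form of a cluster point: the property [P] lets
    the eventual behaviour of other sequences be combined with closeness to
    [l] at one common index. *)
Lemma bounded_seq_cluster (R : realType) m (u : nat -> 'rV[R]_m) (C : R) :
  (forall k, eucl_norm (u k) <= C) ->
  exists l, forall (e : R) (P : nat -> Prop), 0 < e ->
    (\forall k \near \oo, P k) -> exists2 k, P k & ball l e (u k).
Proof.
move=> uC.
have uA : \forall k \near \oo, forall i, `[- C, C]%classic (u k ord0 i).
  apply: nearW => k i; rewrite /= in_itv/= -ler_norml.
  exact: le_trans (entry_le_eucl_norm _ _) (uC k).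
have [l [_ lu]] :=
  @rV_compact _ m (fun=> `[- C, C]%classic) (fun=> @segment_compact R _ _) (u @ \oo) _ uA.
exists l => e P e0 ePt.
have [|_ [[k Pk <-] lk]] := lu (u @` P) (ball l e) _ (nbhsx_ballx _ _ e0).
  by apply: filterS ePt => k Pk; exists k.
by exists k.
Qed.

Lemma increasing_cvgny (phi : nat -> nat) :
  {homo phi : i j / (i < j)%N} -> phi @ \oo --> \oo.
Proof.
move=> phiS; have le_phi k : (k <= phi k)%N.
  by elim: k => // k IH; exact: leq_ltn_trans (phiS _ _ (ltnSn k)).
apply/cvgnyPge => A; exists A => //= k /= Ak; exact: leq_trans (le_phi k).
Qed.

Theorem proposition4p19 (R : realType) (n m : nat) (M : set 'rV[R]_n)
    (K : 'rV[R]_n -> set 'rV[R]_m) (zbar : 'rV[R]_n) :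
  closed M ->
  closed (gph K) ->
  (M `&` dom K) zbar ->
  inner_semicompact_dom K zbar ->
  (forall lambdabar, K zbar lambdabar ->
     metrically_subregular (Upsilon_exp M K) (row_mx zbar lambdabar) 0) ->
  metrically_subregular (Upsilon_imp M K) zbar 0.
Proof.
move=> _ clK [Mz Kz] isc sub_exp; apply: contrapT => nsub.
have MKz : row_setX M (dom K) (row_mx zbar zbar) by rewrite row_setX_row_mx.
have [z [w [zcvg zwcvg MKw ltw]]] :=
  not_subregular0_seq (g := fun z => row_mx z z) MKz nsub.
pose a k := lsubmx (w k); pose b k := rsubmx (w k).
have Ma k : M (a k) by case: (MKw k).
have Kb k : dom K (b k) by case: (MKw k).
have wE k : row_mx (z k) (z k) - w k = row_mx (z k - a k) (z k - b k).
  by rewrite -[w k]hsubmxK opp_row_mx add_row_mx.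
have bcvg : b @ \oo --> zbar.
  have zbcvg : (fun k => z k - b k) @ \oo --> (0 : 'rV[R]_n).
    apply: norm_cvg0; apply: squeeze_cvgr (cvg_cst 0) zwcvg.
    near=> k; rewrite /= normr_ge0 /= wE.
    exact: le_trans (mx_norm_le_eucl_norm _) (le_eucl_norm_row_mxr _ _).
  rewrite -[X in _ --> X]subr0.
  rewrite (_ : b = (fun k => z k - (z k - b k))); first exact: cvgB.
  by apply/funext => k; rewrite subKr.
have [lam [Klam [phi [phiS [C lamC]]]]] := isc b Kb bcvg.
have phicvg := increasing_cvgny phiS.
have [l lP] := bounded_seq_cluster lamC.
have Kl : K zbar l.
  rewrite -gph_row_mx; apply: clK => B /nbhs_row_mx[e e0 eB].
  have [k bk lk] := lP e _ e0 (phicvg _ (bcvg _ (nbhsx_ballx _ _ e0))).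
  exists (row_mx (b (phi k)) (lam (phi k))); split; last exact: eB.
  by rewrite gph_row_mx.
have /metrically_subregular0P[_ [kappa [kappa0 /nbhs_row_mx[e e0 eU]]]] :=
  sub_exp _ Kl.
have zbig : \forall k \near \oo, ball zbar e (z k) /\ kappa <= k.+1%:R.
  apply: filterI; first exact: zcvg _ (nbhsx_ballx _ _ e0).
  by apply: filterS (nbhs_infty_ger kappa) => k /le_trans; apply; rewrite ler_nat.
(* One index where [(z, lam)] lies in the error-bound region around [(zbar, l)]
   and the violation factor exceeds [kappa]. *)
have [k [zk kappak] lk] := lP e _ e0 (phicvg _ zbig).
have := ltw (phi k); apply/negP; rewrite -leNgt wE.
have := eU _ _ zk lk; rewrite row_mxKl row_mxKr => le_exp.
rewrite -[X in eucl_dist X _](row_mxKl (z (phi k)) (lam (phi k))).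
apply: (le_trans (eucl_dist_lsubmx _ _)) (le_trans le_exp _).
  move=> v; rewrite /= !row_setX_row_mx gph_row_mx => -[Mv Kv].
  by split=> //; exists (rsubmx v).
(* Same multiplier as the test point, so the third block of the residual
   vanishes. *)
have MKab : row_setX M (gph K)
    (row_mx (a (phi k)) (row_mx (b (phi k)) (lam (phi k)))).
  by rewrite row_setX_row_mx gph_row_mx.
apply: (@le_trans _ _ (kappa * eucl_norm (row_mx (z (phi k) - a (phi k))
    (z (phi k) - b (phi k))))%:E); last first.
  by rewrite lee_fin ler_wpM2r ?eucl_norm_ge0.
rewrite EFinM; apply: lee_wpmul2l; first by rewrite lee_fin ltW.
apply: le_trans (eucl_dist_le _ MKab) _.
rewrite !(opp_row_mx, add_row_mx) subrr lee_fin.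
by rewrite !(eucl_norm_row_mx (_ - a _)) eucl_norm_row_mx0.
Unshelve. all: by end_near. Qed.
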